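(* Let $X$ be a Banach space and let $U:T\to\mathcal{B}(X)$ be an evolution operator. Then $U$ is weakly exponentially unstable if and only if there are a function $L:T\times X\to\mathbb{R}_{-}$ and constants $M,\omega,m>0$ such that for each $x_0\in X$ there is $t_0\geq 0$ for which all of the following hold: (Lyapunov equation) $L(t,t_0,x_0)+\int_{s}^{t}\|U(\tau,t_0)x_0\|^{2}\,d\tau=L(s,t_0,x_0)$ for all $t\geq s\geq t_0$ (that is, $L$ is a Lyapunov function for $U$, with this choice of $t_0$); (i) $\|U(s,t_0)x_0\|\leq M e^{\omega(t-s)}\|U(t,t_0)x_0\|$ for all $t\geq s\geq t_0$; (ii) $|L(t,t_0,x_0)|\leq m\|U(t,t_0)x_0\|^{2}$ for all $t\geq t_0$.
   Context: $X$ is a Banach space, $\mathcal{B}(X)$ is the Banach algebra of all bounded linear operators on $X$, $\mathbb{R}_+=[0,\infty)$, $\mathbb{R}_-=(-\infty,0]$, and $T=\{(t,s)\in\mathbb{R}_+^2 : t\geq s\}$. A map $U:T\to\mathcal{B}(X)$ is an evolution operator if: $U(t,t)=I$ (the identity on $X$) for every $t\geq 0$; $U(t,s)U(s,t_0)=U(t,t_0)$ for all $(t,s),(s,t_0)\in T$; and for each $x\in X$ the function $T\ni(t,s)\mapsto U(t,s)x\in X$ is continuous. An evolution operator $U$ is weakly exponentially unstable if there are constants $N\geq 1$ and $\nu>0$ such that for each $x_0\in X$ there is $t_0=t_0(x_0)\geq 0$ with $N\|U(t,t_0)x_0\|\geq e^{\nu(t-s)}\|U(s,t_0)x_0\|$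 for all $t\geq s\geq t_0$. A function $L:T\times X\to\mathbb{R}$ is a Lyapunov function for $U$ if for each $x_0\in X$ there is $t_0\geq 0$ such that $L(t,t_0,x_0)+\int_{s}^{t}\|U(\tau,t_0)x_0\|^{2}\,d\tau=L(s,t_0,x_0)$ for all $t\geq s\geq t_0$. *)

(* Defs.v *)
From HB Require Import structures.
From mathcomp Require Import all_boot all_order all_algebra.
From mathcomp Require Import all_classical all_reals all_analysis.

Set Implicit Arguments.
Unset Strict Implicit.
Unset Printing Implicit Defensive.
Import Order.TTheory GRing.Theory Num.Theory.
Import numFieldNormedType.Exports.

Local Open Scope classical_set_scope.
Local Open Scope ring_scope.

(* A map on T = {(t, s) | t >= s >= 0} is represented by a function of two real
   arguments whose values outside of T are irrelevant: every condition below
   only involves its values on T.  The scalars are real; a complex Banach space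
   is also a real one, with the same norm and the same topology, and its
   bounded operators are bounded over the reals. *)
Definition time_pairs (R : realType) : set (R * R) :=
  [set p | 0 <= p.2 /\ p.2 <= p.1].

Definition evolution_operator (R : realType) (X : completeNormedModType R)
    (U : R -> R -> {linear X -> X}) : Prop :=
  [/\ forall t s, time_pairs (t, s) -> bounded_fun_norm (U t s),
      forall t x, 0 <= t -> U t t x = x,
      forall t s t0 x, time_pairs (t, s) -> time_pairs (s, t0) ->
        U t s (U s t0 x) = U t t0 x
    & forall x, {within @time_pairs R, continuous (fun p => U p.1 p.2 x)}].

Definition weakly_exponentially_unstable (R : realType)
    (X : completeNormedModType R) (U : R -> R -> {linear X -> X}) : Prop :=
  exists N nu : R, [/\ 1 <= N, 0 < nu &
    forall x0 : X, exists2 t0 : R, 0 <= t0 &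
      forall t s, t0 <= s -> s <= t ->
        expR (nu * (t - s)) * `|U s t0 x0| <= N * `|U t t0 x0|].

(* Requiring this for every x0, with some t0 >= 0 depending on x0, says that L
   is a Lyapunov function for U.  For an evolution operator the integrand is
   continuous on [s, t], so the real-valued Lebesgue integral is the usual
   one. *)
Definition lyapunov_equation (R : realType) (X : completeNormedModType R)
    (U : R -> R -> {linear X -> X}) (L : R -> R -> X -> R)
    (t0 : R) (x0 : X) : Prop :=
  forall t s, t0 <= s -> s <= t ->
    L t t0 x0
      + \int[@lebesgue_measure R]_(tau in `[s, t]) (`|U tau t0 x0| ^+ 2)
    = L s t0 x0.

(* Main.v *)
Require Import Defs.
From HB Require Import structures.
From mathcomp Require Import all_boot all_order all_algebra.
From mathcomp Require Import all_classical all_reals all_analysis.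
From mathcomp Require Import ring lra.

Set Implicit Arguments.
Unset Strict Implicit.
Unset Printing Implicit Defensive.
Import Order.TTheory GRing.Theory Num.Theory.
Import numFieldNormedType.Exports.

Local Open Scope classical_set_scope.
Local Open Scope ring_scope.

(** Fix a vector and a starting time t0, and write u t for the norm of its
orbit at time t.  Everything then takes place in the real line, on [t0, +oo[.

From instability to a Lyapunov function, take for L minus the integral of u^2
from the starting time.  The Lyapunov equation is additivity of the integral,
and (i) holds because instability gives u s <= N * u t, which is stronger.  For
(ii), read instability backwards from t: u tau ^+ 2 is at most N^2 * u t ^+ 2
times exp (- 2 * nu * (t - tau)), and this exponential has integral at most
1 / (2 * nu) whatever the starting time ([Rintegral_le_expR_growth]).

Conversely, l := - L is nonnegative, grows by the integral of u^2, and satisfies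
l <= m * u^2.  Hence the growth rate of l is at least l / m, so that l grows
exponentially: since l is nondecreasing, it at least doubles over every period
of length m ([expR_doubling_le]).  The growth passes from l to u through
  m * u t ^+ 2 >= l t   and   l (s + 1) >= integral of u^2 over [s, s + 1],
where (i) bounds the last integral below by a multiple of u s ^+ 2; times
t <= s + 1 are covered by (i) directly ([expR_growth_of_lyapunov]). *)

(** The hypothesis [hl] is what remains of m * l' >= l when it is integrated over
[s, t] and l is replaced there by its least value l s.  For t = s + m it
reads 2 * l s <= l (s + m); the factor 2 in the conclusion absorbs the part of
[s, t] left over after the last full period. *)
Lemma expR_doubling_le (R : realType) (l : R -> R) (m a : R) (hm : 0 < m)
    (hl0 : forall t, a <= t -> 0 <= l t)
    (hl : forall t s, a <= s -> s <= t -> (t - s) * l s <= m * (l t - l s))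
    (t s : R) (has : a <= s) (hst : s <= t) :
  expR (ln 2 / m * (t - s)) * l s <= 2 * l t.
Proof.
have double s' : a <= s' -> 2 * l s' <= l (s' + m).
  move=> as'; have := hl (s' + m) s' as'.
  by rewrite lerDl addrAC subrr add0r (ler_pM2l hm) => /(_ (ltW hm)); lra.
have pow2 k : 2 ^+ k * l s <= l (s + m *+ k).
  elim: k => [|k IHk]; first by rewrite expr0 mul1r mulr0n addr0.
  rewrite exprS [m *+ _]mulrSr addrA -mulrA; apply: le_trans (double _ _).
    by rewrite ler_pM2l.
  by rewrite (le_trans has)// lerDl mulrn_wge0// ltW.
have hd : 0 <= (t - s) / m by rewrite divr_ge0 ?subr_ge0// ltW.
pose k := Num.truncn ((t - s) / m).
have /andP[kle ltk] : k%:R <= (t - s) / m < k.+1%:R by exact: truncn_itv.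
have hskt : s + m *+ k <= t.
  by rewrite -mulr_natl -lerBrDl -ler_pdivlMr.
have lmon : l (s + m *+ k) <= l t.
  have ask : a <= s + m *+ k by rewrite (le_trans has)// lerDl mulrn_wge0// ltW.
  have := hl t _ ask hskt.
  have : 0 <= (t - (s + m *+ k)) * l (s + m *+ k).
    by rewrite mulr_ge0 ?subr_ge0// hl0.
  by move=> h1 /(le_trans h1); rewrite pmulr_rge0// subr_ge0.
have hexp : expR (ln 2 / m * (t - s)) <= 2 * 2 ^+ k.
  rewrite -exprS (_ : 2 ^+ k.+1 = expR (k.+1%:R * ln 2)); last first.
    by rewrite mulrC expRM_natr lnK// posrE.
  rewrite ler_expR mulrAC -mulrA mulrC ler_wpM2r//.
    by rewrite ln_ge0// ler1n.
  exact: ltW.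
apply: (le_trans (ler_wpM2r (hl0 _ has) hexp)).
by rewrite -mulrA ler_pM2l// (le_trans (pow2 k)).
Qed.

Lemma integrable_segment (R : realType) (f : R -> R) (s t : R) :
  {within `[s, t], continuous f} ->
  (@lebesgue_measure R).-integrable `[s, t] (EFin \o f).
Proof.
by move=> cf; apply: continuous_compact_integrable => //; exact: segment_compact.
Qed.

Lemma ge_Rintegral_cst (R : realType) (phi : R -> R) (k s t : R) (hst : s <= t)
    (hphi : {within `[s, t], continuous phi})
    (hk : forall tau, s <= tau <= t -> k <= phi tau) :
  k * (t - s) <= \int[@lebesgue_measure R]_(tau in `[s, t]) phi tau.
Proof.
have -> : k * (t - s) = \int[@lebesgue_measure R]_(tau in `[s, t]) k.
  rewrite Rintegral_cst//= lebesgue_measure_itv/= lte_fin.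
  by case: ltP => [//|ts]; rewrite (@le_anti _ _ s t) ?hst ?ts// subrr.
apply: le_Rintegral => //; last exact: integrable_segment.
by apply: integrable_segment; apply: continuous_subspaceT => ?; exact: cvg_cst.
Qed.

Lemma Rintegral_expR (R : realType) (c s t : R) (hst : s <= t) :
  \int[@lebesgue_measure R]_(tau in `[s, t]) (c * expR (c * tau))
  = expR (c * t) - expR (c * s).
Proof.
move: hst; rewrite le_eqVlt => /predU1P[->|st].
  by rewrite set_itv1 Rintegral_set1 subrr.
pose F (x : R) := expR (c * x).
have dF (x : R) : is_derive x 1 F (c * expR (c * x)).
  apply: is_derive_eq; rewrite /GRing.scale/= mulr1 mulrC//.
have cF : continuous F by move=> x; apply/differentiable_continuous/derivable1_diffP.
rewrite /Rintegral (@continuous_FTC2 _ _ F)//.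
- apply: continuous_subspaceT => x; apply: cvgM; first exact: cvg_cst.
  exact: cF.
- split=> [x _||].
  + exact: ex_derive.
  + exact/cvg_at_right_filter/cF.
  + exact/cvg_at_left_filter/cF.
- by move=> x _; rewrite derive1E derive_val.
Qed.

(** The bound does not depend on s: the hypothesis bounds phi tau by
K * exp (- c * (t - tau)), whose integral over ]-oo, t] is K / c. *)
Lemma Rintegral_le_expR_growth (R : realType) (phi : R -> R) (c K s t : R)
    (hc : 0 < c) (hK : 0 <= K) (hst : s <= t)
    (hphi : {within `[s, t], continuous phi})
    (hgrowth : forall tau, s <= tau <= t -> expR (c * (t - tau)) * phi tau <= K) :
  \int[@lebesgue_measure R]_(tau in `[s, t]) phi tau <= K / c.
Proof.
have cexp : {within `[s, t], continuous (fun x : R => c * expR (c * x))}.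
  apply: continuous_subspaceT => x; apply: cvgM; first exact: cvg_cst.
  apply: continuous_comp; last exact: continuous_expR.
  by apply: cvgM; [exact: cvg_cst|exact: cvg_id].
(* d * (c * exp (c * tau)) is the majorant K * exp (- c * (t - tau)), written so
   that its primitive is d * exp (c * tau). *)
pose d := K / c * expR (- (c * t)).
apply: (@le_trans _ _
    (\int[@lebesgue_measure R]_(tau in `[s, t]) (d * (c * expR (c * tau))))).
  apply: le_Rintegral => //; [exact: integrable_segment| |].
    apply: integrable_segment => x; apply: cvgM; [exact: cvg_cst|exact: cexp].
  move=> tau; rewrite /= in_itv/= => /hgrowth.
  rewrite mulrC -ler_pdivlMr ?expR_gt0// -expRN => /le_trans; apply.
  rewrite /d mulrBr opprB expRD le_eqVlt; apply/orP; left; apply/eqP; field.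
  by rewrite gt_eqF.
rewrite RintegralZl//; last exact: integrable_segment.
rewrite Rintegral_expR// /d -mulrA ler_piMr ?divr_ge0 ?(ltW hc)//.
by rewrite mulrBr -expRD addNr expR0 lerBlDr lerDl mulr_ge0 ?expR_ge0.
Qed.

(** Joint continuity on the pairs t >= s >= 0 is restricted to the line s = t0,
which stays among these pairs over [s, t] because 0 <= t0 <= s. *)
Lemma orbit_sqr_norm_continuous (R : realType) (X : completeNormedModType R)
    (U : R -> R -> {linear X -> X}) (hU : evolution_operator U)
    (t0 s t : R) (x0 : X) (ht0 : 0 <= t0) (hs : t0 <= s) :
  {within `[s, t], continuous (fun tau => `|U tau t0 x0| ^+ 2)}.
Proof.
have [_ _ _ /(_ x0)/subspace_continuousP cU] := hU.
apply/subspace_continuousP => tau /=; rewrite in_itv/= => /andP[stau taut].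
have cV : U r t0 x0 @[r --> within `[s, t] (nbhs tau)] --> U tau t0 x0.
  have /cU : time_pairs (tau, t0) by split => //=; exact: le_trans stau.
  apply: cvg_trans => /= A /=.
  move=> [[B C]/= [Btau Ct0] BCA].
  rewrite /nbhs/= /within/=; near=> r => rst.
  apply: (BCA (r, t0)); last first.
    split => //=; move: rst; rewrite in_itv/= => /andP[sr _]; exact: le_trans sr.
  by split => /=; [near: r|exact: nbhs_singleton].
have cN : `|U r t0 x0| @[r --> within `[s, t] (nbhs tau)] --> `|U tau t0 x0|.
  exact: cvg_norm cV.
exact: (cvgM cN cN).
Unshelve. all: by end_near. Qed.

(** Here l stands for minus the Lyapunov function along an orbit and u for the
norm of that orbit.  The rate is ln 2 / (2 * m) because l doubles over each
period m and is compared with the square of u.  The square root of the constant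
2 * m from that comparison is replaced by the larger 1 + 2 * m, which is at
least 1 and so serves also for t <= s + 1. *)
Lemma expR_growth_of_lyapunov (R : realType) (l u : R -> R) (M omega m a : R)
    (hM : 0 < M) (homega : 0 < omega) (hm : 0 < m)
    (hu0 : forall t, 0 <= u t)
    (hcont : forall s t, a <= s -> {within `[s, t], continuous (fun x => u x ^+ 2)})
    (hl0 : forall t, a <= t -> 0 <= l t)
    (hl : forall t s, a <= s -> s <= t ->
      \int[@lebesgue_measure R]_(tau in `[s, t]) (u tau ^+ 2) = l t - l s)
    (hu : forall t s, a <= s -> s <= t -> u s <= M * expR (omega * (t - s)) * u t)
    (hlu : forall t, a <= t -> l t <= m * u t ^+ 2)
    (t s : R) (has : a <= s) (hst : s <= t) :
  expR (ln 2 / (2 * m) * (t - s)) * u s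
  <= (1 + expR (ln 2 / (2 * m)) * ((1 + 2 * m) * (M * expR omega))) * u t.
Proof.
set nu := ln 2 / (2 * m); pose B := M * expR omega.
have B0 : 0 < B by rewrite mulr_gt0 ?expR_gt0.
have nu0 : 0 < nu by rewrite divr_gt0 ?mulr_gt0// ln_gt0// ltr1n.
have uB r : s <= r <= s + 1 -> u s <= B * u r.
  move=> /andP[sr rs1]; apply: le_trans (hu _ _ has sr) _.
  by rewrite ler_wpM2r// ler_pM2l// ler_expR ler_piMr ?(ltW homega)// lerBlDl.
suff main : expR (nu * (t - s)) * u s <= expR nu * ((1 + 2 * m) * B * u t).
  by rewrite (le_trans main)// mulrA [leRHS]mulrDl mul1r lerDr.
have [ts1|ts1] := leP t (s + 1).
  apply: ler_pM; rewrite ?expR_ge0//.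
    by rewrite ler_expR ler_piMr ?(ltW nu0)// lerBlDl.
  rewrite (le_trans (uB t _)) ?hst// ler_wpM2r// ler_peMl ?(ltW B0)//.
  by rewrite lerDl mulr_ge0 ?ltW.
have as1 : a <= s + 1 by rewrite (le_trans has)// lerDl.
(* Both l s' <= l tau and l tau <= m * u tau ^+ 2 are used for the lower bound
   l s' / m of the integrand on [s', t']. *)
have slope t' s' : a <= s' -> s' <= t' -> (t' - s') * l s' <= m * (l t' - l s').
  move=> as' st'; rewrite mulrC -ler_pdivrMl// mulrCA mulrA -hl//.
  apply: ge_Rintegral_cst => //; first exact: hcont.
  move=> tau /andP[stau taut]; rewrite mulrC ler_pdivrMl//.
  rewrite (le_trans _ (hlu _ (le_trans as' stau)))// -subr_ge0 -hl//.
  by apply: Rintegral_ge0 => x _; exact: sqr_ge0.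
have unit_gain : (u s / B) ^+ 2 <= l (s + 1).
  have hs1 : s <= s + 1 by rewrite lerDl.
  have : (u s / B) ^+ 2 * (s + 1 - s) <= l (s + 1) - l s.
    rewrite -hl//; apply: ge_Rintegral_cst => //; first exact: hcont.
    move=> tau /uB; rewrite -ler_pdivrMl// mulrC => h.
    by rewrite ler_sqr ?nnegrE ?divr_ge0// ltW.
  by have := hl0 _ has; lra.
have grow : expR (nu * (t - (s + 1))) ^+ 2 * (u s / B) ^+ 2 <= 2 * m * u t ^+ 2.
  have h := expR_doubling_le hm hl0 slope as1 (ltW ts1).
  apply: (@le_trans _ _ (2 * l t)); last first.
    by rewrite -mulrA ler_pM2l// hlu// (le_trans has).
  apply: le_trans h; rewrite -expRM_natl [2%:R * _]mulrA.
  have -> : 2 * nu = ln 2 / m by rewrite /nu invfM; field; rewrite gt_eqF.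
  by rewrite ler_wpM2l ?expR_ge0.
have grow1 : expR (nu * (t - (s + 1))) * (u s / B) <= (1 + 2 * m) * u t.
  have p0 : 0 <= 1 + 2 * m by rewrite addr_ge0// mulr_ge0// ltW.
  rewrite -ler_sqr ?nnegrE ?mulr_ge0 ?expR_ge0 ?divr_ge0 ?invr_ge0 ?(ltW B0)//.
  rewrite [leLHS]exprMn [leRHS]exprMn (le_trans grow)// ler_wpM2r ?sqr_ge0//.
  (* 2 * m <= (1 + 2 * m) ^+ 2 *)
  by nra.
have -> : nu * (t - s) = nu + nu * (t - (s + 1)) by ring.
rewrite expRD -mulrA ler_pM2l ?expR_gt0// [leRHS]mulrAC -ler_pdivrMr// -mulrA.
exact: grow1.
Qed.

Theorem theorem17 (R : realType) (X : completeNormedModType R)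
    (U : R -> R -> {linear X -> X}) (hU : evolution_operator U) :
  weakly_exponentially_unstable U <->
  exists (L : R -> R -> X -> R) (M omega m : R),
    [/\ forall t s x, time_pairs (t, s) -> L t s x <= 0,
        0 < M, 0 < omega, 0 < m &
        forall x0 : X, exists2 t0 : R, 0 <= t0 &
          [/\ lyapunov_equation U L t0 x0,
              forall t s, t0 <= s -> s <= t ->
                `|U s t0 x0| <= M * expR (omega * (t - s)) * `|U t t0 x0|
            & forall t, t0 <= t -> `|L t t0 x0| <= m * `|U t t0 x0| ^+ 2]].
Proof.
split.
- move=> [N [nu [N1 nu0 hunst]]].
  have N0 : 0 < N by exact: lt_le_trans N1.
  pose L t s x := - \int[@lebesgue_measure R]_(tau in `[s, t]) (`|U tau s x| ^+ 2).
  have int0 t s x : 0 <= \int[@lebesgue_measure R]_(tau in `[s, t]) (`|U tau s x| ^+ 2).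
    by apply: Rintegral_ge0 => ? _; exact: sqr_ge0.
  exists L, N, nu, (N ^+ 2 / (2 * nu)); split => //.
  + by move=> t s x _; rewrite oppr_le0.
  + by rewrite divr_gt0 ?exprn_gt0 ?mulr_gt0.
  move=> x0; have [t0 t00 hx0] := hunst x0; exists t0 => //; split.
  + move=> t s ts st.
    have int : (@lebesgue_measure R).-integrable `[t0, t]
        (EFin \o (fun tau => `|U tau t0 x0| ^+ 2)).
      by apply: integrable_segment; exact: orbit_sqr_norm_continuous.
    have := Rintegral_itvB int (x := s).
    rewrite !bnd_simp => /(_ ts st) h.
    rewrite /L -(@Rintegral_itv_obnd_cbnd _ s) -?h; first by ring.
    by apply: integrableS int => //; apply: subset_itvr; rewrite bnd_simp.
  + move=> t s ts st.
    have e1 : 1 <= expR (nu * (t - s)).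
      by rewrite -expR0 ler_expR mulr_ge0 ?subr_ge0// ltW.
    rewrite -mulrA mulrCA (le_trans _ (ler_peMl _ e1)) ?mulr_ge0 ?(ltW N0)//.
    exact: le_trans (ler_peMl (normr_ge0 _) e1) (hx0 _ _ ts st).
  + move=> t t0t; rewrite normrN ger0_norm// mulrAC.
    apply: Rintegral_le_expR_growth => //.
    * by rewrite mulr_gt0.
    * by rewrite mulr_ge0 ?sqr_ge0.
    * exact: orbit_sqr_norm_continuous.
    move=> tau /andP[t0tau taut].
    rewrite -mulrA expRM_natl -!exprMn ler_sqr ?nnegrE ?mulr_ge0 ?expR_ge0 ?(ltW N0)//.
    exact: hx0.
- move=> [L [M [omega [m [L0 M0 omega0 m0 hL]]]]].
  exists (1 + expR (ln 2 / (2 * m)) * ((1 + 2 * m) * (M * expR omega))).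
  exists (ln 2 / (2 * m)); split.
  + by rewrite lerDl !mulr_ge0 ?expR_ge0 ?addr_ge0 ?mulr_ge0 ?(ltW m0) ?(ltW M0).
  + by rewrite divr_gt0 ?mulr_gt0// ln_gt0// ltr1n.
  move=> x0; have [t0 t00 [lyap hdecay hbound]] := hL x0; exists t0 => // t s ts st.
  apply: (@expR_growth_of_lyapunov _ (fun r => - L r t0 x0) (fun r => `|U r t0 x0|) M omega m t0) => //.
  + by move=> *; exact: orbit_sqr_norm_continuous.
  + by move=> r t0r; rewrite oppr_ge0 L0//; split.
  + by move=> t' s' ts' st'; rewrite -(lyap _ _ ts' st'); ring.
  + by move=> r t0r; rewrite (le_trans _ (hbound _ t0r))// -normrN ler_norm.
Qed.
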